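(* Fix real $c,d>0$, let $g(x)=xF(c,d;c+d;x)$ for $x\in(0,1)$, and let $$D_g(x,y)=g(x)+g(y)-g(x+y-xy),\qquad x,y\in(0,1).$$ (1) If $cd\le 1$, then for all $x,y\in(0,1)$, $$0\le D_g(x,y)<\frac{2R(c,d)+1}{B(c,d)}-1.$$ (2) If $1/c+1/d\le 2$, then for all $x,y\in(0,1)$, $$\frac{2R(c,d)+1}{B(c,d)}-1<D_g(x,y)\le 0.$$
   Context: $F(a,b;c;x)=\sum_{n=0}^{\infty}\frac{(a,n)(b,n)}{(c,n)}\frac{x^n}{n!}$ for $|x|<1$ is the Gaussian hypergeometric function, where $(a,0)=1$ and $(a,n)=a(a+1)\cdots(a+n-1)$ for $n\ge 1$. $\Gamma$ is the Euler gamma function, $\psi=\Gamma'/\Gamma$ is the psi (digamma) function, $B(c,d)=\Gamma(c)\Gamma(d)/\Gamma(c+d)$ is the beta function, and $R(c,d)=-2\gamma-\psi(c)-\psi(d)$, where $\gamma$ is the Euler–Mascheroni constant.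
   Formalization: The strict inequalities with (2R(c,d)+1)/B(c,d) − 1 are asserted only for (c,d) ≠ (1,1); at c = d = 1 both D_g and this bound equal 0, so there only the non-strict inequality is asserted. *)

(* Defs.v *)
From Stdlib Require Import Reals Factorial.
From Coquelicot Require Import Coquelicot.
Open Scope R_scope.

Fixpoint poch (a : R) (n : nat) : R :=
  match n with
  | O => 1
  | S m => poch a m * (a + INR m)
  end.

Definition hyp2F1 (a b c x : R) : R :=
  PSeries (fun n => poch a n * poch b n / poch c n / INR (fact n)) x.

(* Euler's integral, improper at both ends; it converges for [x > 0], the only
   arguments at which [Gamma] is used. *)
Definition Gamma (x : R) : R :=
  RInt_gen (fun t => Rpower t (x - 1) * exp (- t))
           (at_right 0) (Rbar_locally p_infty).

Definition psi (x : R) : R := Derive Gamma x / Gamma x.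

Definition Beta (c d : R) : R := Gamma c * Gamma d / Gamma (c + d).

(* [sum_n u n] has the [n + 1] terms [u 0, ..., u n]: the sequence is
   [H_(n+1) - ln (n+1)]. *)
Definition euler_gamma : R :=
  real (Lim_seq (fun n => sum_n (fun k => / INR (S k)) n - ln (INR (S n)))).

(* The quantity [R(c,d)]; the name [R] is taken by the type of reals. *)
Definition Rcd (c d : R) : R := - 2 * euler_gamma - psi c - psi d.

Definition g (c d x : R) : R := x * hyp2F1 c d (c + d) x.

Definition Dg (c d x y : R) : R := g c d x + g c d y - g c d (x + y - x * y).

(* Main.v *)
(* Write [g x = sum_n alpha_n x^(n+1) / (n+1)].  The sign of
   [alpha_(n+1) - alpha_n] is that of [(cd - 1) n + 2cd - (c + d)], so [alpha] is
   monotone in both cases, with [alpha_0 = 1] and limit [1 / B(c,d)].  Hence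
   [(1 - x) g'(x) = (1 - x) sum_n alpha_n x^n] is monotone, which under
   [x = 1 - exp (- s)] says that [g] is concave or convex in [s]: this is the sign
   of [D_g].  For the other bound, [k x := g x + ln (1 - x) / B(c,d)] has the
   coefficients [(alpha_n - 1 / B) / (n+1)], all of one sign, and the logarithms
   cancel in [D_g x y = k x + k y - k (x + y - x y)]; so [D_g] is bounded by
   [k y], hence by [k 1 = R / B], while [k 1] is bounded by its first
   coefficient [1 - 1 / B] on the side that yields [(2 R + 1) / B - 1].

   The value [k 1 = R / B] says that the sums of
   [T_n - 1 / (n+1)], [T_n = Gamma(c+n) Gamma(d+n) / (Gamma(c+d+n) n!)], tend to
   [R(c,d)].  As functions of [c], both sides decrease and both drop by [1/c] when
   [c] becomes [c+1] (the left one by telescoping, since [n T_n -> 1]), so their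
   difference is constant in [c], likewise in [d], and it vanishes at
   [c = d = 1].  The facts about Gamma and psi come from Wendel's
   inequality [Gamma (z + s) <= z^s Gamma z] for [0 <= s <= 1]. *)
Require Import Defs.
From Stdlib Require Import Reals Factorial Lra Lia.
From Coquelicot Require Import Coquelicot.
Open Scope R_scope.

(** * The Gamma integral *)

Lemma half_line_filter (a0 b0 : R) (P : R * R -> Prop) : 0 < a0 ->
  (forall a b, 0 < a < a0 -> b0 < b -> P (a, b)) ->
  filter_prod (at_right 0) (Rbar_locally p_infty) P.
Proof.
  intros Ha H.
  apply (Filter_prod _ _ _ (fun a => 0 < a < a0) (fun b => b0 < b)).
  - exists (mkposreal a0 Ha). intros y Hy Hy0. simpl in Hy.
    apply Rabs_lt_between' in Hy. lra.
  - exists b0. auto.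
  - auto.
Qed.

(** Since [f] is nonnegative, its integral grows with the interval. The improper integral is
    therefore the supremum [l] of the integrals over compact intervals: once one interval is within
    [eps] of [l], so is every larger one. *)
Lemma half_line_nonneg_integral (f : R -> R) (M : R) :
  (forall t, 0 < t -> continuous f t) -> (forall t, 0 < t -> 0 <= f t) ->
  (forall a b, 0 < a <= b -> RInt f a b <= M) ->
  exists l, is_RInt_gen f (at_right 0) (Rbar_locally p_infty) l /\
    forall a b, 0 < a <= b -> RInt f a b <= l.
Proof.
  intros Hc Hp HM.
  assert (Hex : forall a b, 0 < a -> 0 < b -> ex_RInt f a b).
  { intros a b Ha Hb. apply (ex_RInt_continuous (V := R_CompleteNormedModule)).
    intros z Hz. apply Hc.
    apply Rlt_le_trans with (2 := proj1 Hz). now apply Rmin_glb_lt. }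
  destruct (completeness (fun r => exists a b, 0 < a <= b /\ r = RInt f a b)) as [l [Hl1 Hl2]].
  - exists M. intros r (a & b & Hab & ->). now apply HM.
  - exists (RInt f 1 1), 1, 1. split; [lra|reflexivity].
  - assert (Hle : forall a b, 0 < a <= b -> RInt f a b <= l).
    { intros a b Hab. apply Hl1. now exists a, b. }
    exists l. split; [|exact Hle].
    intros P [eps HP].
    assert (H : exists a b, 0 < a <= b /\ l - eps < RInt f a b).
    { apply Classical_Prop.NNPP. intros Hn.
      assert (l <= l - eps); [|destruct eps; simpl in *; lra].
      apply Hl2. intros r (a & b & Hab & ->).
      apply Rnot_lt_le. intros H. apply Hn. now exists a, b. }
    destruct H as (a0 & b0 & Hab & H0).
    apply (half_line_filter a0 b0); [lra|]. intros a b Ha Hb.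
    exists (RInt f a b). split.
    { apply (RInt_correct f). apply Hex; simpl; lra. }
    apply HP. apply Rabs_lt_between'.
    assert (RInt f a b <= l) by (apply Hle; lra).
    assert (RInt f a0 b0 <= RInt f a b); [|destruct eps; simpl in *; lra].
    rewrite <- (RInt_Chasles f a a0 b) by (apply Hex; lra).
    rewrite <- (RInt_Chasles f a0 b0 b) by (apply Hex; lra).
    assert (0 <= RInt f a a0).
    { apply RInt_ge_0; [lra|apply Hex; lra|intros; apply Hp; lra]. }
    assert (0 <= RInt f b0 b).
    { apply RInt_ge_0; [lra|apply Hex; lra|intros; apply Hp; lra]. }
    unfold plus; simpl. lra.
Qed.

Lemma half_line_FTC (F f : R -> R) (la lb : R) :
  (forall t, 0 < t -> is_derive F t (f t)) -> (forall t, 0 < t -> continuous f t) ->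
  filterlim F (at_right 0) (locally la) -> filterlim F (Rbar_locally p_infty) (locally lb) ->
  is_RInt_gen f (at_right 0) (Rbar_locally p_infty) (lb - la).
Proof.
  intros HF Hf Ha Hb.
  assert (HD : forall t, 0 < t -> Derive F t = f t)
    by (intros; now apply is_derive_unique, HF).
  assert (Hpos : forall a b x, 0 < a < 1 -> 1 < b -> Rmin a b <= x -> 0 < x).
  { intros a b x Ha' Hb' Hx. rewrite Rmin_left in Hx; lra. }
  apply is_RInt_gen_ext with (f := Derive F); try apply _.
  - apply (half_line_filter 1 1); [lra|]. simpl. intros a b Ha' Hb' x [Hx _].
    apply HD. apply (Hpos a b); lra.
  - apply is_RInt_gen_Derive; auto; try apply _;
    apply (half_line_filter 1 1); try lra; simpl; intros a b Ha' Hb' x [Hx _];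
    apply (Hpos a b) in Hx; try lra.
    + eexists; now apply HF.
    (* [Derive F] is known to agree with [f] only on the positive half-line, so the comparison at
       [x] uses the ball of radius [x]. *)
    + apply continuous_ext_loc with (g := f).
      * exists (mkposreal x Hx). intros y Hy. simpl in Hy. apply Rabs_lt_between' in Hy.
        symmetry; apply HD; lra.
      * now apply Hf.
Qed.

Lemma Gamma_integrand_derive (p t : R) : 0 < t ->
  is_derive (fun t => Rpower t p * exp (- t)) t
    (p * Rpower t (p - 1) * exp (- t) - Rpower t p * exp (- t)).
Proof.
  intros Ht. unfold Rpower. auto_derive; [lra|].
  replace (exp ((p - 1) * ln t)) with (exp (p * ln t) / t); [field; lra|].
  rewrite Rmult_minus_distr_r, Rmult_1_l. unfold Rminus.
  rewrite exp_plus, exp_Ropp, exp_ln by assumption. reflexivity.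
Qed.

Lemma Gamma_integrand_continuous (p t : R) : 0 < t ->
  continuous (fun t => Rpower t p * exp (- t)) t.
Proof.
  intros Ht. apply (ex_derive_continuous (fun t => Rpower t p * exp (- t))).
  eexists. now apply Gamma_integrand_derive.
Qed.

Lemma Gamma_integrand_pos (p t : R) : 0 < Rpower t p * exp (- t).
Proof. apply Rmult_lt_0_compat; apply exp_pos. Qed.

Lemma ln_le_minus_1 (u : R) : 0 < u -> ln u <= u - 1.
Proof.
  intros Hu. pose proof (exp_ineq1_le (ln u)) as H. rewrite exp_ln in H by assumption. lra.
Qed.

Lemma Rpower_exp_bound (p : R) : 0 < p ->
  exists C, 0 < C /\ forall t, 0 < t -> Rpower (1 + t) p * exp (- t) <= C.
Proof.
  (* With [u = 1 + t], the exponent [p * ln u + 1 - u] is largest at [u = p]. *)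
  intros Hp. exists (exp (1 + p * ln p - p)). split; [apply exp_pos|]. intros t Ht.
  unfold Rpower. rewrite <- exp_plus.
  assert (p * ln (1 + t) + - t <= 1 + p * ln p - p) as [H|H];
    [|left; now apply exp_increasing|right; now f_equal].
  assert (H : ln ((1 + t) / p) <= (1 + t) / p - 1)
    by (apply ln_le_minus_1, Rdiv_lt_0_compat; lra).
  rewrite ln_div in H by lra.
  apply (Rmult_le_compat_l p) in H; [|lra].
  replace (p * ((1 + t) / p - 1)) with (1 + t - p) in H by (field; lra). lra.
Qed.

(* The integrand is dominated by a multiple of the derivative of [(t / (1 + t)) ^ x]. *)
Lemma Gamma_integral_bounded (x : R) : 0 < x ->
  exists M, forall a b, 0 < a <= b ->
    RInt (fun t => Rpower t (x - 1) * exp (- t)) a b <= M.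
Proof.
  intros Hx. destruct (Rpower_exp_bound (x + 1)) as (C & HC & HCt); [lra|].
  exists (C / x). intros a b Hab.
  set (F := fun t => C / x * exp (x * (ln t - ln (1 + t)))).
  set (f := fun t => C * (Rpower t (x - 1) / Rpower (1 + t) (x + 1))).
  assert (HF : forall t, 0 < t -> is_derive F t (f t)).
  { intros t Ht. unfold F, f. auto_derive; [lra|]. unfold Rpower.
    replace ((x - 1) * ln t) with (x * ln t - ln t) by ring.
    replace ((x + 1) * ln (1 + t)) with (x * ln (1 + t) + ln (1 + t)) by ring.
    replace (x * (ln t + - ln (1 + t))) with (x * ln t + - (x * ln (1 + t))) by ring.
    unfold Rminus. rewrite !exp_plus, !exp_Ropp, !exp_ln by lra.
    field. repeat split; try lra; apply Rgt_not_eq, exp_pos. }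
  assert (Hf : forall t, 0 < t -> continuous f t).
  { intros t Ht. apply (ex_derive_continuous f). unfold f, Rpower. auto_derive.
    repeat split; try lra. apply Rgt_not_eq, exp_pos. }
  assert (HI : is_RInt f a b (F b - F a)).
  { apply (is_RInt_derive F f); intros t; rewrite Rmin_left, Rmax_right by lra; intros Ht.
    - apply HF; lra.
    - apply Hf; lra. }
  apply Rle_trans with (RInt f a b).
  - apply RInt_le; [lra| | |].
    + apply (ex_RInt_continuous (V := R_CompleteNormedModule)).
      intros t; rewrite Rmin_left, Rmax_right by lra; intros Ht.
      apply Gamma_integrand_continuous; lra.
    + eexists; exact HI.
    + intros t Ht. unfold f.
      replace (C * (Rpower t (x - 1) / Rpower (1 + t) (x + 1)))
        with (Rpower t (x - 1) * (C / Rpower (1 + t) (x + 1)))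
        by (unfold Rdiv; ring).
      apply Rmult_le_compat_l; [left; apply exp_pos|].
      apply Rle_div_r; [apply exp_pos|]. rewrite Rmult_comm. apply HCt. lra.
  - rewrite (is_RInt_unique _ _ _ _ HI).
    assert (Hk : 0 < C / x) by (apply Rdiv_lt_0_compat; lra).
    assert (F b <= C / x).
    { unfold F. rewrite <- (Rmult_1_r (C / x)) at 2. apply Rmult_le_compat_l; [lra|].
      assert (ln b < ln (1 + b)) by (apply ln_increasing; lra).
      apply Rle_trans with (exp 0); [left; apply exp_increasing; nra|rewrite exp_0; lra]. }
    assert (0 <= F a) by (apply Rmult_le_pos; [lra|left; apply exp_pos]).
    lra.
Qed.

(** Convergence makes the total operator in [Gamma] an actual integral; it is bounded below by the
    positive integral over [[1, 2]]. *)
Lemma is_RInt_gen_Gamma (x : R) : 0 < x ->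
  is_RInt_gen (fun t => Rpower t (x - 1) * exp (- t)) (at_right 0) (Rbar_locally p_infty) (Gamma x)
  /\ 0 < Gamma x.
Proof.
  intros Hx. destruct (Gamma_integral_bounded x Hx) as [M HM].
  destruct (half_line_nonneg_integral (fun t => Rpower t (x - 1) * exp (- t)) M) as (l & Hl & Hle).
  - intros; now apply Gamma_integrand_continuous.
  - intros; left; apply Gamma_integrand_pos.
  - exact HM.
  - assert (HG : Gamma x = l).
    { apply is_RInt_gen_unique; try exact Hl; apply Proper_StrongProper, _. }
    rewrite HG. split; [exact Hl|].
    apply Rlt_le_trans with (2 := Hle 1 2 ltac:(lra)).
    apply RInt_gt_0; [lra| |].
    + intros; apply Gamma_integrand_pos.
    + intros; apply Gamma_integrand_continuous; lra.
Qed.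

Lemma Gamma_pos (x : R) : 0 < x -> 0 < Gamma x.
Proof. apply is_RInt_gen_Gamma. Qed.

Lemma half_line_unique (f : R -> R) (l1 l2 : R) :
  is_RInt_gen f (at_right 0) (Rbar_locally p_infty) l1 ->
  is_RInt_gen f (at_right 0) (Rbar_locally p_infty) l2 -> l1 = l2.
Proof.
  intros H1 H2.
  rewrite <- (is_RInt_gen_unique (V := R_CompleteNormedModule) f l1 H1).
  now apply (is_RInt_gen_unique (V := R_CompleteNormedModule)).
Qed.

(** The bound at exponent [p + 1] leaves one spare factor [t]: the function is at most [C / t],
    hence below [eps] once [t > C / eps]. *)
Lemma Gamma_integrand_lim_infty (p : R) : 0 <= p ->
  filterlim (fun t => Rpower t p * exp (- t)) (Rbar_locally p_infty) (locally 0).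
Proof.
  intros Hp. destruct (Rpower_exp_bound (p + 1)) as (C & HC & HCt); [lra|].
  intros P [eps HP]. exists (Rmax 0 (C / eps)). intros t Ht.
  assert (0 < t) by (apply Rle_lt_trans with (2 := Ht), Rmax_l).
  assert (Hte : C / eps < t) by (apply Rle_lt_trans with (2 := Ht), Rmax_r).
  apply HP. apply Rabs_lt_between'.
  pose proof (Gamma_integrand_pos p t). destruct eps as [eps He]; simpl in *.
  apply Rlt_div_l in Hte; [|lra].
  split; [lra|]. ring_simplify.
  specialize (HCt t H). rewrite Rpower_plus, Rpower_1 in HCt by lra.
  assert (Rpower t p <= Rpower (1 + t) p) by (apply Rle_Rpower_l; lra).
  pose proof (exp_pos (- t)).
  assert (t * (Rpower t p * exp (- t)) < t * eps); [|nra].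
  apply Rle_lt_trans with C; [|lra].
  apply Rle_trans with (2 := HCt).
  assert (t * Rpower t p <= Rpower (1 + t) p * (1 + t)); [|nra].
  pose proof (exp_pos (p * ln t)). unfold Rpower in *. nra.
Qed.

Lemma Gamma_integrand_lim_0 (p : R) : 0 < p ->
  filterlim (fun t => Rpower t p * exp (- t)) (at_right 0) (locally 0).
Proof.
  intros Hp P [eps HP].
  exists (mkposreal (Rpower eps (/ p)) (exp_pos _)). intros t Ht Ht0.
  simpl in Ht. apply Rabs_lt_between' in Ht.
  apply HP. apply Rabs_lt_between'. pose proof (Gamma_integrand_pos p t).
  destruct eps as [eps He]; simpl in *. split; [lra|]. ring_simplify.
  assert (Rpower t p < eps).
  { apply Rlt_le_trans with (Rpower (Rpower eps (/ p)) p).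
    - apply Rlt_Rpower_l; lra.
    - rewrite Rpower_mult, Rinv_l, Rpower_1; lra. }
  assert (exp (- t) < 1) by (rewrite <- exp_0; apply exp_increasing; lra).
  pose proof (exp_pos (- t)). nra.
Qed.

(** Integration by parts: [x * Gamma x - Gamma (x + 1)] is the integral of the derivative of
    [t ^ x * exp (- t)], which vanishes at both ends. *)
Lemma Gamma_succ (x : R) : 0 < x -> Gamma (x + 1) = x * Gamma x.
Proof.
  intros Hx.
  destruct (is_RInt_gen_Gamma x Hx) as [H1 _].
  destruct (is_RInt_gen_Gamma (x + 1) ltac:(lra)) as [H2 _].
  replace (x + 1 - 1) with x in H2 by ring.
  assert (H3 := is_RInt_gen_minus _ _ _ _ (is_RInt_gen_scal _ x _ H1) H2).
  enough (minus (scal x (Gamma x)) (Gamma (x + 1)) = 0 - 0)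
    by (unfold minus, plus, opp, scal in *; simpl in *; unfold mult in *; simpl in *; lra).
  refine (half_line_unique _ _ _ H3 _).
  apply half_line_FTC with (F := fun t => Rpower t x * exp (- t)).
  - intros t Ht.
    replace (minus _ _) with (x * Rpower t (x - 1) * exp (- t) - Rpower t x * exp (- t)).
    { now apply Gamma_integrand_derive. }
    unfold minus, plus, opp, scal; simpl; unfold mult; simpl. ring.
  - intros t Ht. apply (continuous_minus (fun t => scal x (Rpower t (x - 1) * exp (- t)))).
    + apply (continuous_scal_r x (fun t => Rpower t (x - 1) * exp (- t))).
      now apply Gamma_integrand_continuous.
    + now apply Gamma_integrand_continuous.
  - now apply Gamma_integrand_lim_0.
  - apply Gamma_integrand_lim_infty; lra.
Qed.

Lemma Gamma_1 : Gamma 1 = 1.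
Proof.
  destruct (is_RInt_gen_Gamma 1 ltac:(lra)) as [H1 _].
  apply eq_trans with (- 0 - - 1); [|ring].
  apply (half_line_unique _ _ _ H1).
  apply half_line_FTC with (F := fun t => - exp (- t)).
  - intros t Ht. replace (1 - 1) with 0 by ring. rewrite Rpower_O by assumption.
    auto_derive; trivial. ring.
  - intros; now apply Gamma_integrand_continuous.
  - apply (@filterlim_filter_le_1 _ _ (locally 0)); [intros P [e HP]; exists e; auto|].
    replace (- 1) with (- exp (- 0)) by (rewrite Ropp_0, exp_0; ring).
    apply (ex_derive_continuous (fun t => - exp (- t))). auto_derive; trivial.
  - assert (H := Gamma_integrand_lim_infty 0 (Rle_refl 0)).
    apply (filterlim_comp _ _ _ _ Ropp _ (locally 0)) with (2 := filterlim_opp 0).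
    apply filterlim_ext_loc with (2 := H). exists 0. intros t Ht. rewrite Rpower_O by assumption. ring.
Qed.

(** * Wendel's inequality *)

Lemma Rpower_tangent (u s : R) : 0 < u -> 0 <= s <= 1 -> Rpower u s <= 1 + s * (u - 1).
Proof.
  intros Hu Hs. unfold Rpower.
  set (v := ln u). replace u with (exp v) by (now apply exp_ln).
  (* The tangent of [exp] at [s * v]. Taken at [w = v] with weight [s] and at [w = 0] with weight
     [1 - s], its linear terms cancel. *)
  assert (E : forall w, exp (s * v) * (1 + (w - s * v)) <= exp w).
  { intros w. replace w with (s * v + (w - s * v)) at 2 by ring. rewrite exp_plus.
    apply Rmult_le_compat_l; [left; apply exp_pos|apply exp_ineq1_le]. }
  pose proof (E v) as H1. pose proof (E 0) as H2. rewrite exp_0 in H2.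
  apply (Rmult_le_compat_l s) in H1; [|lra].
  apply (Rmult_le_compat_l (1 - s)) in H2; [|lra]. nra.
Qed.

(** The tangent bound at [t / z] gives [t ^ s <= z ^ s * (1 + s * (t / z - 1))]. Integrated against
    [t ^ (z - 1) * exp (- t)], the linear correction vanishes because
    [Gamma (z + 1) = z * Gamma z]. *)
Lemma Gamma_Wendel (z s : R) : 0 < z -> 0 <= s <= 1 -> Gamma (z + s) <= Rpower z s * Gamma z.
Proof.
  intros Hz Hs.
  destruct (is_RInt_gen_Gamma z Hz) as [H1 _].
  destruct (is_RInt_gen_Gamma (z + 1) ltac:(lra)) as [H2 _].
  destruct (is_RInt_gen_Gamma (z + s) ltac:(lra)) as [H3 _].
  rewrite Gamma_succ in H2 by assumption.
  assert (H4 := is_RInt_gen_plus _ _ _ _ (is_RInt_gen_scal _ (Rpower z s * (1 - s)) _ H1)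
    (is_RInt_gen_scal _ (Rpower z s * s / z) _ H2)).
  (* The integrals are compared through a norm bound; the integrand is positive, so its norm is
     itself. *)
  apply Rle_trans with (1 := Rle_abs _).
  replace (Rpower z s * Gamma z) with
    (plus (scal (Rpower z s * (1 - s)) (Gamma z)) (scal (Rpower z s * s / z) (z * Gamma z))).
  2: { unfold plus, scal; simpl; unfold mult; simpl. field. lra. }
  refine (RInt_gen_norm _ _ _ _ _ _ H3 H4); apply (half_line_filter 1 1); try lra;
    simpl; intros a b Ha Hb; [lra|]. intros t Ht.
  unfold norm, plus, scal; simpl; unfold abs, mult; simpl.
  rewrite Rabs_pos_eq by (left; apply Gamma_integrand_pos).
  replace (z + s - 1) with (z - 1 + s) by ring.
  replace (z + 1 - 1) with (z - 1 + 1) by ring.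
  rewrite !(Rpower_plus _ _ t), (Rpower_1 t) by lra.
  assert (Hts : Rpower t s = Rpower z s * Rpower (t / z) s).
  { rewrite Rpower_mult_distr; [f_equal; field; lra|lra|apply Rdiv_lt_0_compat; lra]. }
  assert (Htz : Rpower (t / z) s <= 1 + s * (t / z - 1))
    by (apply Rpower_tangent; [apply Rdiv_lt_0_compat; lra|lra]).
  rewrite Hts.
  apply Rle_trans with (Rpower t (z - 1) * exp (- t) * Rpower z s * (1 + s * (t / z - 1))).
  - replace (Rpower t (z - 1) * (Rpower z s * Rpower (t / z) s) * exp (- t))
      with (Rpower t (z - 1) * exp (- t) * Rpower z s * Rpower (t / z) s) by ring.
    apply Rmult_le_compat_l with (2 := Htz).
    apply Rmult_le_pos; left; [apply Gamma_integrand_pos|apply exp_pos].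
  - right. field. lra.
Qed.

(** * The digamma function *)

(** Unlike [sum_n u N], this sum has [N] terms and is empty at [0], where the telescoping inductions
    start. *)
Fixpoint psum (u : nat -> R) (N : nat) : R :=
  match N with O => 0 | S m => psum u m + u m end.

Lemma psum_sum_n (u : nat -> R) (N : nat) : psum u (S N) = sum_n u N.
Proof.
  induction N as [|N IH]; [rewrite sum_O; simpl; ring|].
  rewrite sum_Sn, <- IH. reflexivity.
Qed.

Lemma psum_minus (u v : nat -> R) (N : nat) :
  psum (fun k => u k - v k) N = psum u N - psum v N.
Proof. induction N as [|N IH]; simpl; [ring|rewrite IH; ring]. Qed.

Lemma psum_scal (a : R) (u : nat -> R) (N : nat) :
  psum (fun k => a * u k) N = a * psum u N.
Proof. induction N as [|N IH]; simpl; [ring|rewrite IH; ring]. Qed.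

Lemma psum_le (u v : nat -> R) (N : nat) :
  (forall k, u k <= v k) -> psum u N <= psum v N.
Proof. intros H; induction N as [|N IH]; simpl; [lra|specialize (H N); lra]. Qed.

Lemma psum_head (u : nat -> R) (N : nat) : psum u (S N) = u O + psum (fun k => u (S k)) N.
Proof. induction N as [|N IH]; simpl in *; [ring|rewrite IH; ring]. Qed.

Lemma lim_inv_shift (x : R) : is_lim_seq (fun n => / (x + INR n)) 0.
Proof.
  apply (is_lim_seq_inv _ p_infty); [|discriminate].
  apply is_lim_seq_plus with (l1 := x) (l2 := p_infty);
    [apply is_lim_seq_const|apply is_lim_seq_INR|reflexivity].
Qed.

Lemma shift_pos (x : R) (n : nat) : 0 < x -> 0 < x + INR n.
Proof. intros; pose proof (pos_INR n); lra. Qed.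

Lemma ln_diff_bounds (u v : R) : 0 < u -> 0 < v ->
  (v - u) / v <= ln v - ln u <= (v - u) / u.
Proof.
  intros Hu Hv.
  pose proof (ln_le_minus_1 (v / u) ltac:(apply Rdiv_lt_0_compat; lra)) as H1.
  pose proof (ln_le_minus_1 (u / v) ltac:(apply Rdiv_lt_0_compat; lra)) as H2.
  rewrite ln_div in H1, H2 by lra.
  replace ((v - u) / v) with (1 - u / v) by (field; lra).
  replace ((v - u) / u) with (v / u - 1) by (field; lra). lra.
Qed.

Lemma lim_ln_shift (x y : R) : 0 < x -> 0 < y ->
  is_lim_seq (fun n => ln (y + INR n) - ln (x + INR n)) 0.
Proof.
  intros Hx Hy.
  assert (H : forall z, is_lim_seq (fun n => (y - x) * / (z + INR n)) 0).
  { intros z. replace (Finite 0) with (Rbar_mult (y - x) 0) by (simpl; f_equal; ring).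
    apply is_lim_seq_scal_l, lim_inv_shift. }
  apply is_lim_seq_le_le with (2 := H y) (3 := H x). intros n.
  pose proof (ln_diff_bounds (x + INR n) (y + INR n) (shift_pos x n Hx) (shift_pos y n Hy)) as HB.
  replace (y + INR n - (x + INR n)) with (y - x) in HB by ring. exact HB.
Qed.

(** * Asymptotics of [ln Gamma] under shifts *)

Definition lnGamma (x : R) : R := ln (Gamma x).

Lemma lnGamma_succ (x : R) : 0 < x -> lnGamma (x + 1) = ln x + lnGamma x.
Proof.
  intros Hx. unfold lnGamma. rewrite Gamma_succ by assumption.
  apply ln_mult; [assumption|now apply Gamma_pos].
Qed.

Lemma lnGamma_Wendel (z s : R) : 0 < z -> 0 <= s <= 1 ->
  lnGamma (z + s) <= s * ln z + lnGamma z.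
Proof.
  intros Hz Hs. unfold lnGamma.
  pose proof (Gamma_Wendel z s Hz Hs) as H.
  apply ln_le in H; [|apply Gamma_pos; lra].
  rewrite ln_mult, ln_Rpower in H by (try apply Gamma_pos; try apply exp_pos; lra).
  exact H.
Qed.

(** A squeeze. Wendel at [z = x + n] gives the upper bound; Wendel from [z + s] by [1 - s] reaches
    [z + 1] and gives the lower bound, up to a multiple of [ln (z + s) - ln z]. *)
Lemma lnGamma_shift_unit (x s : R) : 0 < x -> 0 <= s <= 1 ->
  is_lim_seq (fun n => lnGamma (x + INR n + s) - lnGamma (x + INR n) - s * ln (x + INR n)) 0.
Proof.
  intros Hx Hs.
  apply is_lim_seq_le_le with (w := fun _ => 0)
    (u := fun n => - (1 - s) * (ln (x + s + INR n) - ln (x + INR n))).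
  - intros n. pose proof (shift_pos x n Hx) as Hz.
    set (z := x + INR n) in *.
    pose proof (lnGamma_Wendel z s Hz Hs).
    pose proof (lnGamma_Wendel (z + s) (1 - s) ltac:(lra) ltac:(lra)) as H2.
    replace (z + s + (1 - s)) with (z + 1) in H2 by ring.
    rewrite lnGamma_succ in H2 by assumption.
    replace (x + s + INR n) with (z + s) by (unfold z; ring). lra.
  - replace (Finite 0) with (Rbar_mult (- (1 - s)) 0) by (simpl; f_equal; ring).
    apply is_lim_seq_scal_l, lim_ln_shift; lra.
  - apply is_lim_seq_const.
Qed.

Lemma lim_eq_0 (u v : nat -> R) (l : R) : is_lim_seq u l -> l = 0 ->
  (forall n, v n = u n) -> is_lim_seq v 0.
Proof.
  intros Hu <- H. apply is_lim_seq_ext with (2 := Hu). now symmetry.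
Qed.

(** Induction on the integer part of [s]: by the functional equation each unit adds a difference
    [ln (z + s) - ln z], which tends to [0]. *)
Lemma lnGamma_shift_nonneg (x s : R) : 0 < x -> 0 <= s ->
  is_lim_seq (fun n => lnGamma (x + INR n + s) - lnGamma (x + INR n) - s * ln (x + INR n)) 0.
Proof.
  intros Hx Hs. destruct (nfloor_ex s Hs) as [k Hk].
  assert (Hr : 0 <= s - INR k <= 1) by lra.
  replace s with ((s - INR k) + INR k) by ring.
  revert Hr. generalize (s - INR k). clear s Hs Hk. intros s Hs. induction k as [|k IH].
  - simpl INR. rewrite Rplus_0_r. now apply lnGamma_shift_unit.
  - pose proof (pos_INR k) as Hk.
    apply lim_eq_0 with (1 := is_lim_seq_plus' _ _ _ _ IH
      (lim_ln_shift x (x + (s + INR k)) Hx ltac:(lra))); [ring|].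
    intros n. pose proof (pos_INR n). rewrite S_INR.
    replace (x + INR n + (s + (INR k + 1))) with (x + INR n + (s + INR k) + 1) by ring.
    rewrite lnGamma_succ by lra.
    replace (x + (s + INR k) + INR n) with (x + INR n + (s + INR k)) by ring. ring.
Qed.

Lemma lnGamma_shift (x s : R) : 0 < x -> 0 < x + s ->
  is_lim_seq (fun n => lnGamma (x + INR n + s) - lnGamma (x + INR n) - s * ln (x + INR n)) 0.
Proof.
  intros Hx Hs. destruct (Rle_or_lt 0 s) as [H|H]; [now apply lnGamma_shift_nonneg|].
  (* A negative shift from [x] is read as a positive shift from [x + s]. *)
  pose proof (lnGamma_shift_nonneg (x + s) (- s) Hs ltac:(lra)) as H1.
  apply lim_eq_0 with (1 := is_lim_seq_minus' _ _ _ _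
      (is_lim_seq_scal_l _ s _ (lim_ln_shift x (x + s) Hx Hs)) H1).
  - simpl; ring.
  - intros n. replace (x + INR n + s) with (x + s + INR n) by ring.
    replace (x + s + INR n + - s) with (x + INR n) by ring. ring.
Qed.

(** * The limit formula for digamma *)

Definition psi_seq (x : R) (N : nat) : R := ln (x + INR N) - psum (fun k => / (x + INR k)) N.

Definition digamma (x : R) : R := real (Lim_seq (psi_seq x)).

(** The sequence decreases, by at most [1 / (x + n) - 1 / (x + n + 1)] at step [n]; these bounds
    telescope, so it is bounded below. *)
Lemma digamma_lim (x : R) : 0 < x -> is_lim_seq (psi_seq x) (digamma x).
Proof.
  intros Hx. unfold digamma. apply Lim_seq_correct'.
  assert (Hd : forall n, / (x + INR (S n)) - / (x + INR n) <= psi_seq x (S n) - psi_seq x n <= 0).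
  { intros n. unfold psi_seq. simpl psum. pose proof (shift_pos x n Hx) as Hz.
    rewrite S_INR. pose proof (ln_diff_bounds (x + INR n) (x + (INR n + 1)) Hz ltac:(lra)) as H.
    replace (x + (INR n + 1) - (x + INR n)) with 1 in H by ring. unfold Rdiv in H. lra. }
  apply ex_finite_lim_seq_decr with (M := psi_seq x 0 - / (x + INR 0)).
  - intros n. specialize (Hd n). lra.
  - intros n. apply Rle_trans with (psi_seq x 0 - / (x + INR 0) + / (x + INR n)).
    + pose proof (Rinv_0_lt_compat _ (shift_pos x n Hx)). lra.
    + induction n as [|n IH]; [lra|]. specialize (Hd n). lra.
Qed.

Lemma lnGamma_add_nat (x : R) (N : nat) : 0 < x ->
  lnGamma (x + INR N) = lnGamma x + psum (fun k => ln (x + INR k)) N.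
Proof.
  intros Hx. induction N as [|N IH]; [simpl; now rewrite !Rplus_0_r|].
  rewrite S_INR, <- Rplus_assoc, lnGamma_succ, IH by now apply shift_pos.
  simpl. ring.
Qed.

(** Makes [digamma] a subgradient of [lnGamma], from which monotonicity and differentiability
    follow. At stage [n] it is the termwise bound [ln (y + k) - ln (x + k) <= (y - x) / (x + k)];
    the rest is the shift asymptotics. *)
Lemma lnGamma_tangent (x y : R) : 0 < x -> 0 < y ->
  (y - x) * digamma x <= lnGamma y - lnGamma x.
Proof.
  intros Hx Hy.
  pose proof (lnGamma_shift x (y - x) Hx ltac:(lra)) as H1.
  pose proof (is_lim_seq_scal_l _ (y - x) _ (digamma_lim x Hx)) as H2.
  pose proof (is_lim_seq_minus' _ _ _ _ (is_lim_seq_const (lnGamma y - lnGamma x)) H2) as H3.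
  assert (H : Rbar_le 0 (lnGamma y - lnGamma x - (y - x) * digamma x)); [|simpl in H; lra].
  apply (is_lim_seq_le _ _ _ _) with (2 := H1) (3 := H3).
  intros n. replace (x + INR n + (y - x)) with (y + INR n) by ring.
  rewrite !lnGamma_add_nat by assumption. unfold psi_seq.
  enough (psum (fun k => ln (y + INR k) - ln (x + INR k)) n
    <= psum (fun k => (y - x) * / (x + INR k)) n)
    by (rewrite psum_minus, psum_scal in H; lra).
  apply psum_le. intros k.
  pose proof (ln_diff_bounds (x + INR k) (y + INR k) (shift_pos x k Hx) (shift_pos y k Hy)) as HB.
  replace (y + INR k - (x + INR k)) with (y - x) in HB by ring. apply HB.
Qed.

Lemma digamma_incr (x y : R) : 0 < x -> x <= y -> digamma x <= digamma y.
Proof.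
  intros Hx [Hxy|<-]; [|lra].
  pose proof (lnGamma_tangent x y ltac:(lra) ltac:(lra)).
  pose proof (lnGamma_tangent y x ltac:(lra) ltac:(lra)). nra.
Qed.

(** The first [/ m] bounds the contribution of the logarithms. The sums contribute at most [y - x]
    times the sum of [1 / (m + k) ^ 2], which is at most [/ (m * m) + / m] by telescoping after the
    first term. *)
Lemma digamma_Lipschitz (m x y : R) : 0 < m -> m <= x -> x <= y ->
  digamma y - digamma x <= (y - x) * (/ m + (/ (m * m) + / m)).
Proof.
  intros Hm Hmx Hxy.
  assert (Hps : forall N, psum (fun k => / (x + INR k) - / (y + INR k)) (S N)
    <= (y - x) * (/ (m * m) + / m - / (m + INR N))).
  { assert (Hk : forall k, / (x + INR k) - / (y + INR k) <= (y - x) * / ((m + INR k) * (m + INR k))).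
    { intros k. pose proof (pos_INR k).
      replace (/ (x + INR k) - / (y + INR k)) with ((y - x) * / ((x + INR k) * (y + INR k)))
        by (field; lra).
      apply Rmult_le_compat_l; [lra|]. apply Rinv_le_contravar; nra. }
    induction N as [|N IH].
    - simpl psum. specialize (Hk O). simpl in Hk. simpl.
      rewrite !Rplus_0_r in *. lra.
    - change (psum (fun k => / (x + INR k) - / (y + INR k)) (S (S N)))
        with (psum (fun k => / (x + INR k) - / (y + INR k)) (S N)
          + (/ (x + INR (S N)) - / (y + INR (S N)))).
      specialize (Hk (S N)).
      assert (/ ((m + INR (S N)) * (m + INR (S N))) <= / (m + INR N) - / (m + INR (S N))); [|nra].
      rewrite S_INR. pose proof (pos_INR N).
      replace (/ (m + INR N) - / (m + (INR N + 1)))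
        with (/ ((m + INR N) * (m + (INR N + 1)))) by (field; lra).
      apply Rinv_le_contravar; nra. }
  pose proof (is_lim_seq_minus' _ _ _ _ (proj1 (is_lim_seq_incr_1 _ _) (digamma_lim y ltac:(lra)))
    (proj1 (is_lim_seq_incr_1 _ _) (digamma_lim x ltac:(lra)))) as H.
  apply (is_lim_seq_le _ (fun _ => (y - x) * (/ m + (/ (m * m) + / m))) _
    ((y - x) * (/ m + (/ (m * m) + / m)))) in H;
    [exact H| |apply is_lim_seq_const].
  intros N. specialize (Hps N). rewrite psum_minus in Hps. unfold psi_seq.
  pose proof (ln_diff_bounds (x + INR (S N)) (y + INR (S N))
    ltac:(apply shift_pos; lra) ltac:(apply shift_pos; lra)) as [_ Hl].
  replace (y + INR (S N) - (x + INR (S N))) with (y - x) in Hl by ring. unfold Rdiv in Hl.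
  assert (/ (x + INR (S N)) <= / m) by (apply Rinv_le_contravar; pose proof (pos_INR (S N)); lra).
  pose proof (Rinv_0_lt_compat _ (shift_pos m N Hm)). nra.
Qed.

(** The tangent inequalities at [x] and [x + h] put [lnGamma (x + h) - lnGamma x - h * digamma x]
    between [0] and [h * (digamma (x + h) - digamma x)], hence below [K * h ^ 2]; [K] is the
    Lipschitz constant on [[x / 2, oo)]. *)
Lemma is_derive_lnGamma (x : R) : 0 < x -> is_derive lnGamma x (digamma x).
Proof.
  intros Hx. set (K := / (x / 2) + (/ (x / 2 * (x / 2)) + / (x / 2))).
  assert (HK : 0 < K).
  { assert (0 < / (x / 2)) by (apply Rinv_0_lt_compat; lra).
    assert (0 < / (x / 2 * (x / 2))) by (apply Rinv_0_lt_compat; nra). unfold K; lra. }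
  assert (Hq : forall y, x / 2 <= y -> (y - x) * (digamma y - digamma x) <= K * ((y - x) * (y - x))).
  { intros y Hy. destruct (Rle_or_lt x y) as [H|H].
    - pose proof (digamma_Lipschitz (x / 2) x y ltac:(lra) ltac:(lra) H). fold K in H0. nra.
    - pose proof (digamma_Lipschitz (x / 2) y x ltac:(lra) ltac:(lra) ltac:(lra)). fold K in H0. nra. }
  apply is_derive_Reals. intros eps He.
  assert (Hd : 0 < Rmin (x / 2) (eps / K)) by (apply Rmin_glb_lt; [lra|now apply Rdiv_lt_0_compat]).
  exists (mkposreal _ Hd). intros h Hh0 Hh. simpl in Hh.
  assert (Hh1 : Rabs h < x / 2) by (apply Rlt_le_trans with (1 := Hh), Rmin_l).
  assert (Hh2 : Rabs h < eps / K) by (apply Rlt_le_trans with (1 := Hh), Rmin_r).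
  apply Rabs_lt_between in Hh1.
  pose proof (lnGamma_tangent x (x + h) ltac:(lra) ltac:(lra)) as H1.
  pose proof (lnGamma_tangent (x + h) x ltac:(lra) ltac:(lra)) as H2.
  pose proof (Hq (x + h) ltac:(lra)) as H3.
  replace (x + h - x) with h in * by ring.
  replace (x - (x + h)) with (- h) in * by ring.
  replace ((lnGamma (x + h) - lnGamma x) / h - digamma x)
    with ((lnGamma (x + h) - lnGamma x - h * digamma x) / h) by (field; assumption).
  rewrite Rabs_div by assumption.
  apply Rlt_div_l; [now apply Rabs_pos_lt|].
  rewrite Rabs_pos_eq by lra.
  apply Rlt_div_r in Hh2; [|assumption].
  apply Rle_lt_trans with (K * (h * h)); [lra|].
  assert (h * h = Rabs h * Rabs h) by (rewrite <- Rabs_mult; symmetry; apply Rabs_pos_eq; nra).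
  pose proof (Rabs_pos_lt h Hh0). rewrite H. nra.
Qed.

Lemma psi_digamma (x : R) : 0 < x -> psi x = digamma x.
Proof.
  intros Hx. unfold psi.
  assert (H : is_derive Gamma x (digamma x * Gamma x)).
  { apply is_derive_ext_loc with (f := fun y => exp (lnGamma y)).
    - exists (mkposreal x Hx). intros y Hy. simpl in Hy. apply Rabs_lt_between' in Hy.
      apply exp_ln, Gamma_pos; lra.
    - rewrite <- (exp_ln (Gamma x)) by now apply Gamma_pos.
      apply (is_derive_comp exp lnGamma); [|now apply is_derive_lnGamma].
      apply is_derive_exp. }
  rewrite (is_derive_unique _ _ _ H). field.
  apply Rgt_not_eq. now apply Gamma_pos.
Qed.

(** [psi_seq x (n + 1)] and [psi_seq (x + 1) n] have the same logarithm and differ exactly by the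
    first term [/ x]. *)
Lemma psi_succ (x : R) : 0 < x -> psi (x + 1) = psi x + / x.
Proof.
  intros Hx. rewrite !psi_digamma by lra.
  pose proof (digamma_lim (x + 1) ltac:(lra)) as H1.
  pose proof (is_lim_seq_plus' _ _ _ _ (proj1 (is_lim_seq_incr_1 _ _) (digamma_lim x Hx))
    (is_lim_seq_const (/ x))) as H2.
  apply is_lim_seq_unique in H1. apply is_lim_seq_unique in H2.
  enough (Finite (digamma (x + 1)) = Finite (digamma x + / x)) by congruence.
  rewrite <- H1, <- H2. apply Lim_seq_ext. intros n. unfold psi_seq.
  rewrite psum_head, S_INR. change (INR 0) with 0. rewrite Rplus_0_r.
  replace (x + (INR n + 1)) with (x + 1 + INR n) by ring.
  replace (psum (fun k => / (x + INR (S k))) n) with (psum (fun k => / (x + 1 + INR k)) n).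
  - ring.
  - clear. induction n as [|n IH]; [reflexivity|].
    cbn [psum]. rewrite IH, S_INR. do 2 f_equal. ring.
Qed.

Lemma psi_incr (x y : R) : 0 < x -> x <= y -> psi x <= psi y.
Proof. intros. rewrite !psi_digamma by lra. now apply digamma_incr. Qed.

Lemma psi_1 : psi 1 = - euler_gamma.
Proof.
  rewrite psi_digamma by lra. unfold euler_gamma.
  rewrite (is_lim_seq_unique _ (- digamma 1)); [simpl; ring|].
  pose proof (proj1 (is_lim_seq_incr_1 _ _) (digamma_lim 1 ltac:(lra))) as H1.
  (* Next to the same [n + 1] harmonic terms, [psi_seq] has [ln (n + 2)] and [euler_gamma] has
     [ln (n + 1)]; the difference tends to [0]. *)
  pose proof (is_lim_seq_minus' _ _ _ _ (lim_ln_shift 1 2 ltac:(lra) ltac:(lra)) H1) as H2.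
  rewrite Rminus_0_l in H2. apply is_lim_seq_ext with (2 := H2).
  intros n. unfold psi_seq. rewrite psum_sum_n, S_INR.
  replace (1 + (INR n + 1)) with (2 + INR n) by ring.
  rewrite (Rplus_comm (INR n) 1).
  rewrite (sum_n_ext (fun k => / INR (S k)) (fun k => / (1 + INR k))).
  - ring.
  - intros k. rewrite S_INR. f_equal. ring.
Qed.

(** * The sum equal to R(c,d) *)

Definition gauss_term (c d : R) (n : nat) : R :=
  Gamma (c + INR n) * Gamma (d + INR n) / (Gamma (c + d + INR n) * INR (fact n)).

Lemma gauss_term_pos (c d : R) (n : nat) : 0 < c -> 0 < d -> 0 < gauss_term c d n.
Proof.
  intros Hc Hd. unfold gauss_term.
  apply Rdiv_lt_0_compat; apply Rmult_lt_0_compat;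
    try (apply Gamma_pos, shift_pos; lra). apply INR_fact_lt_0.
Qed.

Lemma gauss_term_comm (c d : R) (n : nat) : gauss_term c d n = gauss_term d c n.
Proof. unfold gauss_term. rewrite (Rplus_comm d c), (Rmult_comm (Gamma (d + _))). reflexivity. Qed.

Lemma gauss_term_S (c d : R) (n : nat) : 0 < c -> 0 < d ->
  gauss_term c d (S n) =
  gauss_term c d n * ((c + INR n) * (d + INR n) / ((c + d + INR n) * (INR n + 1))).
Proof.
  intros Hc Hd. unfold gauss_term.
  rewrite fact_simpl, mult_INR, S_INR, <- !Rplus_assoc.
  rewrite !Gamma_succ by (apply shift_pos; lra).
  pose proof (pos_INR n). pose proof (INR_fact_lt_0 n).
  pose proof (Gamma_pos (c + d + INR n) ltac:(lra)).
  field. repeat split; lra.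
Qed.

Lemma gauss_term_succ_l (c d : R) (n : nat) : 0 < c -> 0 < d ->
  gauss_term (c + 1) d n = gauss_term c d n * ((c + INR n) / (c + d + INR n)).
Proof.
  intros Hc Hd. unfold gauss_term.
  replace (c + 1 + INR n) with (c + INR n + 1) by ring.
  replace (c + 1 + d + INR n) with (c + d + INR n + 1) by ring.
  rewrite !Gamma_succ by (apply shift_pos; lra).
  pose proof (pos_INR n). pose proof (INR_fact_lt_0 n).
  pose proof (Gamma_pos (c + d + INR n) ltac:(lra)).
  field. repeat split; lra.
Qed.

Lemma poch_Gamma (a : R) (n : nat) : 0 < a -> Gamma (a + INR n) = poch a n * Gamma a.
Proof.
  intros Ha. induction n as [|n IH]; [simpl; rewrite Rplus_0_r; ring|].
  rewrite S_INR, <- Rplus_assoc, Gamma_succ, IH by now apply shift_pos. simpl. ring.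
Qed.

Lemma poch_pos (a : R) (n : nat) : 0 < a -> 0 < poch a n.
Proof.
  intros Ha. induction n as [|n IH]; simpl; [lra|].
  apply Rmult_lt_0_compat; [exact IH|now apply shift_pos].
Qed.

Lemma Beta_pos (c d : R) : 0 < c -> 0 < d -> 0 < Beta c d.
Proof.
  intros. apply Rdiv_lt_0_compat; [apply Rmult_lt_0_compat|]; apply Gamma_pos; lra.
Qed.

Lemma gauss_term_coeff (c d : R) (n : nat) : 0 < c -> 0 < d ->
  poch c n * poch d n / poch (c + d) n / INR (fact n) = gauss_term c d n / Beta c d.
Proof.
  intros Hc Hd. unfold gauss_term, Beta. rewrite !poch_Gamma by lra.
  pose proof (INR_fact_lt_0 n). pose proof (poch_pos (c + d) n ltac:(lra)).
  pose proof (Gamma_pos c Hc). pose proof (Gamma_pos d Hd).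
  pose proof (Gamma_pos (c + d) ltac:(lra)).
  field. repeat split; lra.
Qed.

Lemma gauss_term_1_1 (n : nat) : gauss_term 1 1 n = / (INR n + 1).
Proof.
  induction n as [|n IH].
  - unfold gauss_term. simpl. rewrite !Rplus_0_r, Gamma_succ, Gamma_1 by lra. field.
  - rewrite gauss_term_S, IH, S_INR by lra. pose proof (pos_INR n). field. lra.
Qed.

(** At index [n + 1] this is the ratio of [Gamma (n + 1 + c) / Gamma (n + 1)] to [Gamma (n + 1 + d +
    c) / Gamma (n + 1 + d)]; both behave like [n ^ c]. *)
Lemma gauss_term_lim (c d : R) : 0 < c -> 0 < d ->
  is_lim_seq (fun n => INR n * gauss_term c d n) 1.
Proof.
  intros Hc Hd. apply is_lim_seq_incr_1.
  pose proof (is_lim_seq_minus' _ _ _ _ (lnGamma_shift 1 c ltac:(lra) ltac:(lra))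
    (lnGamma_shift (1 + d) c ltac:(lra) ltac:(lra))) as H1.
  pose proof (is_lim_seq_minus' _ _ _ _ H1
    (is_lim_seq_scal_l _ c _ (lim_ln_shift 1 (1 + d) ltac:(lra) ltac:(lra)))) as H2.
  apply (is_lim_seq_continuous exp) in H2; [|apply derivable_continuous_pt, derivable_pt_exp].
  replace (exp (0 - 0 - c * 0)) with 1 in H2
    by (rewrite Rmult_0_r, !Rminus_0_r; symmetry; apply exp_0).
  apply is_lim_seq_ext with (2 := H2). intros n. pose proof (pos_INR n) as Hn.
  replace (lnGamma (1 + INR n + c) - lnGamma (1 + INR n) - c * ln (1 + INR n) -
    (lnGamma (1 + d + INR n + c) - lnGamma (1 + d + INR n) - c * ln (1 + d + INR n)) -
    c * (ln (1 + d + INR n) - ln (1 + INR n)))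
    with (lnGamma (1 + INR n + c) + lnGamma (1 + d + INR n) +
      - (lnGamma (1 + INR n) + lnGamma (1 + d + INR n + c))) by ring.
  rewrite exp_plus, exp_Ropp, !exp_plus. unfold lnGamma.
  rewrite !exp_ln by (apply Gamma_pos; lra).
  assert (Hf : forall m, Gamma (1 + INR m) = INR (fact m)).
  { induction m as [|m IH]; [simpl; rewrite Rplus_0_r; apply Gamma_1|].
    rewrite S_INR, <- Rplus_assoc, Gamma_succ, IH, fact_simpl, mult_INR, S_INR
      by (apply shift_pos; lra). ring. }
  rewrite Hf. unfold gauss_term. rewrite fact_simpl, mult_INR, S_INR.
  replace (c + (INR n + 1)) with (1 + INR n + c) by ring.
  replace (d + (INR n + 1)) with (1 + d + INR n) by ring.
  replace (c + d + (INR n + 1)) with (1 + d + INR n + c) by ring.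
  pose proof (INR_fact_lt_0 n).
  pose proof (Gamma_pos (1 + d + INR n + c) ltac:(lra)).
  field. repeat split; lra.
Qed.

(** The sequence increases to its limit [1], with increments [T_n * c * d / (c + d + n)]. *)
Lemma gauss_term_le (c d : R) (n : nat) : 0 < c -> 0 < d -> INR n * gauss_term c d n <= 1.
Proof.
  intros Hc Hd.
  apply (is_lim_seq_incr_compare (fun n => INR n * gauss_term c d n)); [now apply gauss_term_lim|].
  clear n. intros n. rewrite gauss_term_S, S_INR by assumption.
  pose proof (pos_INR n). pose proof (gauss_term_pos c d n Hc Hd).
  assert (0 <= gauss_term c d n * (c * d / (c + d + INR n))).
  { apply Rmult_le_pos; [lra|]. apply Rlt_le, Rdiv_lt_0_compat; [nra|lra]. }
  replace ((INR n + 1) *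
      (gauss_term c d n * ((c + INR n) * (d + INR n) / ((c + d + INR n) * (INR n + 1)))))
    with (INR n * gauss_term c d n + gauss_term c d n * (c * d / (c + d + INR n)))
    by (field; lra). lra.
Qed.

(* The ratio of the two sides is monotone in [n] and tends to [1]. *)
Lemma gauss_term_antitone (c c' d : R) (n : nat) : 0 < c -> c <= c' -> 0 < d ->
  gauss_term c' d n <= gauss_term c d n.
Proof.
  intros Hc Hcc Hd.
  pose proof (gauss_term_pos c d n Hc Hd) as Hp.
  enough (gauss_term c' d n / gauss_term c d n <= 1)
    by (apply Rle_div_l in H; [lra|assumption]).
  apply (is_lim_seq_incr_compare (fun n => gauss_term c' d n / gauss_term c d n)).
  - apply is_lim_seq_incr_1.
    pose proof (proj1 (is_lim_seq_incr_1 _ _) (gauss_term_lim c d Hc Hd)) as H1.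
    pose proof (proj1 (is_lim_seq_incr_1 _ _) (gauss_term_lim c' d ltac:(lra) Hd)) as H2.
    pose proof (is_lim_seq_div' _ _ _ _ H2 H1 ltac:(lra)) as H3.
    rewrite Rdiv_1_r in H3. apply is_lim_seq_ext with (2 := H3). intros m.
    pose proof (gauss_term_pos c d (S m) Hc Hd). pose proof (pos_INR m). rewrite S_INR. field. lra.
  - clear n Hp. intros n. rewrite !gauss_term_S by lra.
    pose proof (gauss_term_pos c d n Hc Hd). pose proof (gauss_term_pos c' d n ltac:(lra) Hd).
    pose proof (pos_INR n).
    replace (gauss_term c' d n * _ / _) with (gauss_term c' d n / gauss_term c d n *
      (((c' + INR n) * (c + d + INR n)) / ((c + INR n) * (c' + d + INR n))))
      by (field; repeat split; lra).
    rewrite <- (Rmult_1_r (gauss_term c' d n / gauss_term c d n)) at 1.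
    apply Rmult_le_compat_l; [apply Rlt_le, Rdiv_lt_0_compat; lra|].
    apply Rle_div_r; nra.
Qed.

Definition gauss_sum (c d : R) (N : nat) : R :=
  psum (fun n => gauss_term c d n - / (INR n + 1)) N.

(** Passing from [c] to [c + 1] lowers [T_n] by [T_n * d / (c + d + n)], which is
    [((n + 1) * T_(n+1) - n * T_n) / c]. *)
Lemma gauss_sum_succ_l (c d : R) (N : nat) : 0 < c -> 0 < d ->
  gauss_sum c d N - gauss_sum (c + 1) d N = INR N * gauss_term c d N / c.
Proof.
  intros Hc Hd. unfold gauss_sum. induction N as [|N IH]; [simpl; field; lra|].
  cbn [psum].
  rewrite gauss_term_succ_l, gauss_term_S, S_INR by assumption.
  pose proof (pos_INR N).
  fold (gauss_sum c d N) (gauss_sum (c + 1) d N) in *.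
  replace (gauss_sum c d N + (gauss_term c d N - / (INR N + 1)) -
    (gauss_sum (c + 1) d N + (gauss_term c d N * ((c + INR N) / (c + d + INR N)) - / (INR N + 1))))
    with (gauss_sum c d N - gauss_sum (c + 1) d N + gauss_term c d N * (d / (c + d + INR N)))
    by (field; lra).
  rewrite IH. field. lra.
Qed.

Lemma gauss_sum_antitone (c c' d : R) (N : nat) : 0 < c -> c <= c' -> 0 < d ->
  gauss_sum c' d N <= gauss_sum c d N.
Proof.
  intros. apply psum_le. intros k.
  pose proof (gauss_term_antitone c c' d k). lra.
Qed.

(** * The limit of the sums, by moving both parameters to [1] *)

Definition gauss_err (c d : R) (N : nat) : R := gauss_sum c d N - Rcd c d.

Lemma Rcd_succ_l (c d : R) : 0 < c -> Rcd (c + 1) d = Rcd c d - / c.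
Proof. intros Hc. unfold Rcd. rewrite psi_succ by assumption. ring. Qed.

Lemma Rcd_antitone (c c' d : R) : 0 < c -> c <= c' -> Rcd c' d <= Rcd c d.
Proof. intros. unfold Rcd. pose proof (psi_incr c c'). lra. Qed.

Lemma gauss_err_shift (c d : R) (M : nat) : 0 < c -> 0 < d ->
  is_lim_seq (fun N => gauss_err c d N - gauss_err (c + INR M) d N) 0.
Proof.
  intros Hc Hd. induction M as [|M IH].
  - apply is_lim_seq_ext with (2 := is_lim_seq_const 0). intros n. simpl. rewrite Rplus_0_r. ring.
  - pose proof (shift_pos c M Hc) as Hz.
    pose proof (is_lim_seq_minus' _ _ _ _
      (is_lim_seq_scal_r _ (/ (c + INR M)) _ (gauss_term_lim (c + INR M) d Hz Hd))
      (is_lim_seq_const (/ (c + INR M)))) as H.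
    apply lim_eq_0 with (1 := is_lim_seq_plus' _ _ _ _ IH H); [ring|].
    intros n. pose proof (gauss_sum_succ_l (c + INR M) d n Hz Hd) as H1.
    unfold gauss_err. rewrite S_INR, <- Rplus_assoc, Rcd_succ_l by assumption.
    unfold Rdiv in H1. lra.
Qed.

(** From [k] to [k + 1] both [gauss_sum] and [Rcd] decrease, by at most [/ k] in total, so their
    drops up to [c] differ by at most [/ k]. *)
Lemma gauss_err_between (k c d : R) (N : nat) : 0 < k -> k <= c <= k + 1 -> 0 < d ->
  Rabs (gauss_err c d N - gauss_err k d N) <= / k.
Proof.
  intros Hk Hc Hd. unfold gauss_err.
  pose proof (gauss_sum_antitone k c d N Hk (proj1 Hc) Hd).
  pose proof (gauss_sum_antitone c (k + 1) d N ltac:(lra) (proj2 Hc) Hd).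
  pose proof (gauss_sum_succ_l k d N Hk Hd).
  pose proof (Rcd_antitone k c d Hk (proj1 Hc)).
  pose proof (Rcd_antitone c (k + 1) d ltac:(lra) (proj2 Hc)).
  rewrite Rcd_succ_l in * by assumption.
  assert (INR N * gauss_term k d N / k <= / k).
  { unfold Rdiv. rewrite <- (Rmult_1_l (/ k)) at 2. apply Rmult_le_compat_r.
    - left; now apply Rinv_0_lt_compat.
    - now apply gauss_term_le. }
  apply Rabs_le. lra.
Qed.

Lemma gauss_err_1 (c d : R) : 0 < c -> 0 < d ->
  is_lim_seq (fun N => gauss_err c d N - gauss_err 1 d N) 0.
Proof.
  intros Hc Hd. apply is_lim_seq_spec. intros [eps He]. simpl.
  (* Shift [c] by [M + 1] and [1] up to the integer part of [c + M + 1]. That integer is at least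
     [M + 1 > 3 / eps], so the remaining gap costs less than [eps / 3]. *)
  destruct (nfloor_ex (3 / eps)) as [M HM]; [apply Rlt_le, Rdiv_lt_0_compat; lra|].
  destruct (nfloor_ex (c + INR (S M))) as [k Hk]; [apply Rlt_le, shift_pos; lra|].
  destruct k as [|k]; [rewrite S_INR in Hk; pose proof (pos_INR M); simpl in Hk; lra|].
  assert (HMk : (S M <= S k)%nat).
  { enough (S M < S (S k))%nat by lia. apply INR_lt. rewrite (S_INR (S k)). lra. }
  apply le_INR in HMk.
  assert (Hk0 : / INR (S k) < eps / 3).
  { replace (eps / 3) with (/ (3 / eps)) by (field; lra).
    apply Rinv_lt_contravar; rewrite ?S_INR in *.
    - apply Rmult_lt_0_compat; [apply Rdiv_lt_0_compat; lra|pose proof (pos_INR k); lra].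
    - lra. }
  pose proof (proj2 (is_lim_seq_spec _ _) (gauss_err_shift c d (S M) Hc Hd)) as H1.
  pose proof (proj2 (is_lim_seq_spec _ _) (gauss_err_shift 1 d k Rlt_0_1 Hd)) as H2.
  assert (He3 : 0 < eps / 3) by lra.
  specialize (H1 (mkposreal _ He3)). specialize (H2 (mkposreal _ He3)). cbn [pos] in H1, H2.
  generalize (filter_and _ _ H1 H2). apply filter_imp. intros N [HN1 HN2].
  replace (1 + INR k) with (INR (S k)) in HN2 by (rewrite S_INR; ring).
  pose proof (gauss_err_between (INR (S k)) (c + INR (S M)) d N
    ltac:(apply lt_0_INR; lia) ltac:(lra) Hd) as H3.
  rewrite Rminus_0_r in *.
  apply Rabs_lt_between in HN1. apply Rabs_lt_between in HN2. apply Rabs_le_between in H3.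
  apply Rabs_lt_between. lra.
Qed.

Lemma gauss_sum_lim (c d : R) : 0 < c -> 0 < d -> is_lim_seq (gauss_sum c d) (Rcd c d).
Proof.
  intros Hc Hd.
  (* By symmetry the second argument can be moved to [1] like the first; at [(1, 1)] every term of
     the sum is zero and so is [Rcd]. *)
  assert (Hs : forall a b N, gauss_err a b N = gauss_err b a N).
  { intros a b N. unfold gauss_err, gauss_sum. f_equal; [|unfold Rcd; ring].
    induction N as [|N IH]; simpl; [reflexivity|]. now rewrite IH, gauss_term_comm. }
  assert (H11 : forall N, gauss_err 1 1 N = 0).
  { intros N. unfold gauss_err. replace (Rcd 1 1) with 0 by (unfold Rcd; rewrite psi_1; ring).
    rewrite Rminus_0_r. unfold gauss_sum. induction N as [|N IH]; simpl; [reflexivity|].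
    rewrite IH, gauss_term_1_1. ring. }
  pose proof (is_lim_seq_plus' _ _ _ _
    (is_lim_seq_plus' _ _ _ _ (gauss_err_1 c d Hc Hd) (gauss_err_1 d 1 Hd Rlt_0_1))
    (is_lim_seq_const (Rcd c d))) as H.
  replace (0 + 0 + Rcd c d) with (Rcd c d) in H by ring.
  apply is_lim_seq_ext with (2 := H). intros n.
  rewrite (Hs 1 d), H11. unfold gauss_err. ring.
Qed.

(** * Power series with monotone coefficients *)

Lemma bounded_CV_radius (a : nat -> R) (M x : R) : (forall n, Rabs (a n) <= M) -> Rabs x < 1 ->
  Rbar_lt (Rabs x) (CV_radius a).
Proof.
  intros HM Hx. apply Rbar_lt_le_trans with 1; [exact Hx|].
  apply (CV_radius_bounded a). exists M. intros n. rewrite pow1, Rmult_1_r. apply HM.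
Qed.

Lemma bounded_ex_pseries (a : nat -> R) (M x : R) : (forall n, Rabs (a n) <= M) -> 0 <= x < 1 ->
  ex_pseries a x.
Proof.
  intros HM Hx. apply CV_radius_inside, bounded_CV_radius with M; [exact HM|].
  rewrite Rabs_pos_eq; lra.
Qed.

Lemma PSeries_nonneg_incr (b : nat -> R) (x z : R) : (forall n, 0 <= b n) ->
  ex_pseries b z -> 0 <= x <= z -> PSeries b x <= PSeries b z.
Proof.
  intros Hb Hz Hx. apply Series_le; [|now apply ex_pseries_R]. intros n. split.
  - apply Rmult_le_pos; [apply Hb|now apply pow_le].
  - apply Rmult_le_compat_l; [apply Hb|now apply pow_incr].
Qed.

Lemma Rabs_div_succ (u M : R) (n : nat) : Rabs u <= M -> Rabs (u / (INR n + 1)) <= M.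
Proof.
  intros HM. pose proof (pos_INR n) as Hn. rewrite Rabs_div, (Rabs_pos_eq (INR n + 1)) by lra.
  apply Rle_div_l; [lra|]. pose proof (Rabs_pos u). nra.
Qed.

(** The primitive of [PSeries alpha] vanishing at [0], with [x] factored out as in [g]. *)
Definition int_series (alpha : nat -> R) (x : R) : R :=
  x * PSeries (fun n => alpha n / (INR n + 1)) x.

Lemma is_derive_int_series (alpha : nat -> R) (M x : R) : (forall n, Rabs (alpha n) <= M) ->
  0 <= x < 1 -> is_derive (int_series alpha) x (PSeries alpha x).
Proof.
  intros HM Hx. set (a := fun n => alpha n / (INR n + 1)).
  apply is_derive_ext with (f := PSeries (PS_incr_1 a)); [intros t; apply PSeries_incr_1|].
  rewrite (PSeries_ext alpha (PS_derive (PS_incr_1 a))).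
  - apply is_derive_PSeries. rewrite CV_radius_incr_1.
    apply bounded_CV_radius with M; [|rewrite Rabs_pos_eq; lra].
    intros n. now apply Rabs_div_succ.
  - intros n. unfold PS_derive, PS_incr_1, a. rewrite S_INR. pose proof (pos_INR n). field. lra.
Qed.

Lemma one_minus_PSeries_antitone (alpha : nat -> R) (M x z : R) :
  (forall n, Rabs (alpha n) <= M) -> (forall n, alpha (S n) <= alpha n) -> 0 <= x <= z -> z < 1 ->
  (1 - z) * PSeries alpha z <= (1 - x) * PSeries alpha x.
Proof.
  intros HM Hd Hx Hz. set (delta := fun n => alpha n - alpha (S n)).
  (* Summation by parts: multiplying by [1 - t] leaves a series in the nonnegative differences
     [delta], whose sum increases with [t]. *)
  assert (E : forall t, 0 <= t < 1 -> (1 - t) * PSeries alpha t = alpha O - t * PSeries delta t).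
  { intros t Ht.
    assert (PSeries delta t = PSeries alpha t - PSeries (PS_decr_1 alpha) t).
    { rewrite <- PSeries_minus by (apply bounded_ex_pseries with M; try assumption;
        intros n; apply HM). reflexivity. }
    pose proof (PSeries_decr_1 alpha t ltac:(now apply bounded_ex_pseries with M)). nra. }
  rewrite !E by lra.
  assert (Hdp : forall n, 0 <= delta n) by (intros n; specialize (Hd n); unfold delta; lra).
  assert (Hex : forall t, 0 <= t < 1 -> ex_pseries delta t).
  { intros t Ht. apply bounded_ex_pseries with (2 * M); [|assumption]. intros n. unfold delta.
    pose proof (HM n) as H1. pose proof (HM (S n)) as H2.
    apply Rabs_le_between in H1. apply Rabs_le_between in H2. apply Rabs_le. lra. }
  pose proof (PSeries_nonneg_incr delta x z Hdp (Hex z ltac:(lra)) Hx).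
  pose proof (PSeries_nonneg_incr delta 0 x Hdp (Hex x ltac:(lra)) ltac:(lra)) as H0.
  rewrite PSeries_0 in H0. specialize (Hdp O).
  nra.
Qed.

(** [x + y - x * y] is [1 - (1 - x) * (1 - y)], the probabilistic sum; under [x = 1 - exp (- s)] it
    is addition of the [s]. *)
Definition prob_sum_defect (f : R -> R) (x y : R) : R := f x + f y - f (x + y - x * y).

(* With [x = 1 - exp (- s)] the function becomes concave in [s], its derivative
   in [s] being [(1 - x) * PSeries alpha x]. *)
Lemma int_series_subadditive (alpha : nat -> R) (M x y : R) :
  (forall n, Rabs (alpha n) <= M) -> (forall n, alpha (S n) <= alpha n) ->
  0 < x < 1 -> 0 < y < 1 -> 0 <= prob_sum_defect (int_series alpha) x y.
Proof.
  intros HM Hd Hx Hy.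
  set (f := fun t => prob_sum_defect (int_series alpha) t y).
  set (df := fun t => PSeries alpha t - (1 - y) * PSeries alpha (t + y - t * y)).
  assert (Hdf : forall t, 0 <= t <= x -> is_derive f t (df t)).
  { intros t Ht. unfold f, df, prob_sum_defect.
    apply (is_derive_minus (fun t => int_series alpha t + int_series alpha y)).
    - rewrite <- (Rplus_0_r (PSeries alpha t)).
      apply (is_derive_plus (int_series alpha)).
      + apply is_derive_int_series with M; [assumption|lra].
      + apply (is_derive_const (int_series alpha y)).
    - apply (is_derive_comp (int_series alpha) (fun t => t + y - t * y)).
      + apply is_derive_int_series with M; [assumption|]. nra.
      + auto_derive; trivial. ring. }
  destruct (MVT_gen f 0 x df) as (t & Ht & Heq).
  - intros t Ht. rewrite Rmin_left, Rmax_right in Ht by lra. apply Hdf; lra.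
  - intros t Ht. rewrite Rmin_left, Rmax_right in Ht by lra.
    apply continuity_pt_filterlim, (ex_derive_continuous f). eexists. apply Hdf; lra.
  - rewrite Rmin_left, Rmax_right in Ht by lra.
    assert (Hf0 : f 0 = 0).
    { unfold f, prob_sum_defect. replace (0 + y - 0 * y) with y by ring.
      unfold int_series at 1. ring. }
    rewrite Hf0 in Heq. fold (f x).
    assert (0 <= df t); [|nra].
    (* Antitonicity from [t] to [t + y - t * y], where [1 - x] becomes [(1 - t) * (1 - y)]; the
       factor [1 - t] cancels. *)
    pose proof (one_minus_PSeries_antitone alpha M t (t + y - t * y) HM Hd
      ltac:(nra) ltac:(nra)) as H.
    unfold df.
    replace (1 - (t + y - t * y)) with ((1 - t) * (1 - y)) in H by ring.
    rewrite Rmult_assoc in H. apply Rmult_le_reg_l in H; lra.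
Qed.

Lemma int_series_scal (k : R) (alpha : nat -> R) (x : R) :
  int_series (fun n => k * alpha n) x = k * int_series alpha x.
Proof.
  unfold int_series.
  rewrite (PSeries_ext _ (PS_scal k (fun n => alpha n / (INR n + 1)))).
  - rewrite PSeries_scal. ring.
  - intros n. unfold PS_scal, scal; simpl; unfold mult; simpl. unfold Rdiv. ring.
Qed.

(* [int_series] of the constant [1] is [- ln (1 - x)]. *)
Lemma int_series_1_additive (x y : R) : 0 < x < 1 -> 0 < y < 1 ->
  prob_sum_defect (int_series (fun _ => 1)) x y = 0.
Proof.
  intros Hx Hy.
  (* Both constants [1] and [-1] are antitone sequences, so the defect is nonnegative and
     nonpositive. *)
  pose proof (int_series_subadditive (fun _ => 1) 1 x y
    ltac:(intros; cbv beta; rewrite Rabs_R1; lra) ltac:(intros; lra) Hx Hy) as H1.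
  pose proof (int_series_subadditive (fun _ => (-1) * 1) 1 x y
    ltac:(intros; cbv beta; rewrite Rmult_1_r, Rabs_m1; lra) ltac:(intros; lra) Hx Hy) as H2.
  unfold prob_sum_defect in *. rewrite !int_series_scal in H2. lra.
Qed.

(** Splitting [l] off the coefficients removes a logarithm, whose defect is zero; the remaining
    coefficients [e n] are nonnegative with sum [L], so [e O <= PSeries e y <= L]. *)
Lemma int_series_defect_bounds (alpha : nat -> R) (l L x y : R) :
  (forall n, alpha (S n) <= alpha n) -> is_lim_seq alpha l ->
  is_series (fun n => (alpha n - l) / (INR n + 1)) L ->
  0 < x < 1 -> 0 < y < 1 ->
  0 <= prob_sum_defect (int_series alpha) x y <= L /\ alpha O - l <= L /\
  (l < alpha O -> prob_sum_defect (int_series alpha) x y < L).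
Proof.
  intros Hd Hl HL Hx Hy.
  assert (Hlb : forall n, l <= alpha n) by now apply is_lim_seq_decr_compare.
  assert (Hub : forall n, alpha n <= alpha O).
  { intros n. induction n as [|n IH]; [lra|]. specialize (Hd n). lra. }
  assert (HM : forall n, Rabs (alpha n) <= Rabs l + Rabs (alpha O)).
  { intros n. apply Rabs_le. specialize (Hlb n). specialize (Hub n).
    pose proof (Rle_abs l). pose proof (Rle_abs (alpha O)).
    pose proof (Rabs_maj2 l). pose proof (Rabs_maj2 (alpha O)).
    pose proof (Rabs_pos l). pose proof (Rabs_pos (alpha O)). lra. }
  pose proof (int_series_subadditive _ _ x y HM Hd Hx Hy) as H0.
  set (e := fun n => (alpha n - l) / (INR n + 1)) in *.
  assert (Hep : forall n, 0 <= e n).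
  { intros n. unfold e. pose proof (pos_INR n). specialize (Hlb n). apply Rdiv_le_0_compat; lra. }
  assert (HeM : forall n, Rabs (alpha n - l) <= alpha O - l).
  { intros n. specialize (Hlb n). specialize (Hub n). rewrite Rabs_pos_eq; lra. }
  assert (Hex : forall t, 0 <= t < 1 -> ex_pseries e t).
  { intros t Ht. apply bounded_ex_pseries with (alpha O - l); [|assumption].
    intros n. apply Rabs_div_succ, HeM. }
  assert (E : forall t, 0 <= t < 1 ->
    int_series alpha t = t * PSeries e t + l * int_series (fun _ => 1) t).
  { intros t Ht. rewrite <- int_series_scal. unfold int_series.
    rewrite <- Rmult_plus_distr_l. f_equal. rewrite <- PSeries_plus.
    - apply PSeries_ext. intros n. unfold PS_plus, plus, e; simpl.
      pose proof (pos_INR n). field. lra.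
    - now apply Hex.
    - apply bounded_ex_pseries with (Rabs (l * 1)); [|assumption].
      intros n. apply Rabs_div_succ. lra. }
  assert (He0 : e O = alpha O - l) by (unfold e; simpl; field).
  pose proof (int_series_1_additive x y Hx Hy) as H1.
  assert (HyL : PSeries e y <= L).
  { rewrite <- (is_series_unique _ _ HL). apply Series_le; [|now exists L].
    intros n. split.
    - apply Rmult_le_pos; [apply Hep|apply pow_le; lra].
    - rewrite <- (Rmult_1_r (e n)) at 2. apply Rmult_le_compat_l; [apply Hep|].
      rewrite <- (pow1 n). apply pow_incr; lra. }
  assert (Hy0 : forall t, 0 <= t < 1 -> e O <= PSeries e t).
  { intros t Ht. rewrite <- (PSeries_0 e). apply PSeries_nonneg_incr; auto; lra. }
  set (z := x + y - x * y).
  assert (Hz : x < z < 1) by (unfold z; nra).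
  pose proof (PSeries_nonneg_incr e x z Hep (Hex z ltac:(lra)) ltac:(lra)) as Hxz.
  pose proof (Hy0 y ltac:(lra)) as Hey. pose proof (Hy0 x ltac:(lra)) as Hex'.
  assert (HD : prob_sum_defect (int_series alpha) x y
    = x * PSeries e x + y * PSeries e y - z * PSeries e z).
  { unfold prob_sum_defect in *. fold z in H1 |- *. rewrite !E by lra. nra. }
  pose proof (Hep O).
  (* Leaves the defect at most [y * PSeries e y - (z - x) * e O], which is strictly below [L] as
     soon as [e O > 0]. *)
  assert (x * PSeries e x + (z - x) * e O <= z * PSeries e z) by nra.
  rewrite <- He0 in *. repeat split; [exact H0| |lra|intros Hlt; assert (0 < e O) by lra]; nra.
Qed.

(** * The zero-balanced hypergeometric function *)

Definition g_coeff (c d : R) (n : nat) : R := (INR n + 1) * gauss_term c d n / Beta c d.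

Lemma g_int_series (c d x : R) : 0 < c -> 0 < d -> g c d x = int_series (g_coeff c d) x.
Proof.
  intros Hc Hd. unfold g, hyp2F1, int_series. f_equal. apply PSeries_ext. intros n.
  rewrite gauss_term_coeff by assumption. unfold g_coeff.
  pose proof (Beta_pos c d Hc Hd). pose proof (pos_INR n). field. lra.
Qed.

(** Over a common denominator the numerator is [(n + 2) * (c + n) * (d + n) - (n + 1) ^ 2 * (c + d +
    n)], whose cubic and quadratic terms in [n] cancel. *)
Lemma g_coeff_increment (c d : R) (n : nat) : 0 < c -> 0 < d -> exists k, 0 < k /\
  g_coeff c d (S n) - g_coeff c d n = k * ((c * d - 1) * INR n + (2 * (c * d) - (c + d))).
Proof.
  intros Hc Hd. pose proof (pos_INR n). pose proof (Beta_pos c d Hc Hd).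
  pose proof (gauss_term_pos c d n Hc Hd).
  exists (gauss_term c d n / (Beta c d * ((c + d + INR n) * (INR n + 1)))). split.
  - apply Rdiv_lt_0_compat; [assumption|].
    apply Rmult_lt_0_compat; [assumption|apply Rmult_lt_0_compat; lra].
  - unfold g_coeff. rewrite gauss_term_S, S_INR by assumption. field. lra.
Qed.

Lemma g_coeff_0 (c d : R) : 0 < c -> 0 < d -> g_coeff c d 0 = 1.
Proof.
  intros Hc Hd. unfold g_coeff, gauss_term, Beta. simpl. rewrite !Rplus_0_r.
  pose proof (Gamma_pos c Hc). pose proof (Gamma_pos d Hd).
  pose proof (Gamma_pos (c + d) ltac:(lra)). field. lra.
Qed.

Lemma g_coeff_lim (c d : R) : 0 < c -> 0 < d -> is_lim_seq (g_coeff c d) (1 / Beta c d).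
Proof.
  intros Hc Hd.
  pose proof (gauss_term_lim c d Hc Hd) as H.
  pose proof (is_lim_seq_plus' _ _ _ _ H (is_lim_seq_mult' _ _ _ _ H (lim_inv_shift 0))) as H1.
  replace (1 + 1 * 0) with 1 in H1 by ring.
  pose proof (is_lim_seq_scal_r _ (/ Beta c d) _ H1) as H2.
  apply is_lim_seq_ext_loc with (2 := H2). exists 1%nat. intros n Hn.
  apply lt_0_INR in Hn. unfold g_coeff, Rdiv. field.
  pose proof (Beta_pos c d Hc Hd). lra.
Qed.

Lemma g_coeff_series (c d : R) : 0 < c -> 0 < d ->
  is_series (fun n => (g_coeff c d n - 1 / Beta c d) / (INR n + 1)) (Rcd c d / Beta c d).
Proof.
  intros Hc Hd. pose proof (Beta_pos c d Hc Hd).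
  pose proof (is_lim_seq_scal_r _ (/ Beta c d) _
    (proj1 (is_lim_seq_incr_1 _ _) (gauss_sum_lim c d Hc Hd))) as H1.
  apply (is_lim_seq_ext _ (sum_n (fun n => (g_coeff c d n - 1 / Beta c d) / (INR n + 1)))) in H1;
    [exact H1|].
  intros n. unfold gauss_sum. rewrite Rmult_comm, <- psum_scal, psum_sum_n.
  apply sum_n_ext. intros m. simpl. unfold g_coeff. pose proof (pos_INR m). field. lra.
Qed.

(* The increment at [1] is used because the one at [0] may vanish when [c * d > 1]. *)
Lemma defect_bounds (c d s x y : R) : 0 < c -> 0 < d -> s * s = 1 ->
  s * (c * d - 1) <= 0 -> s * (2 * (c * d) - (c + d)) <= 0 ->
  0 < x < 1 -> 0 < y < 1 ->
  0 <= s * Dg c d x y <= s * ((2 * Rcd c d + 1) / Beta c d - 1) /\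
  (~ (c = 1 /\ d = 1) -> s * Dg c d x y < s * ((2 * Rcd c d + 1) / Beta c d - 1)).
Proof.
  intros Hc Hd Hs Hp1 Hp2 Hx Hy.
  pose proof (Beta_pos c d Hc Hd) as HB.
  (* The sign [s = 1] or [s = -1] makes the coefficients antitone, so one argument serves both
     cases. *)
  set (alpha := fun n => s * g_coeff c d n). set (l := s * (1 / Beta c d)).
  assert (Hdec : forall n, alpha (S n) <= alpha n).
  { intros n. destruct (g_coeff_increment c d n Hc Hd) as (k & Hk & E).
    pose proof (pos_INR n). unfold alpha.
    assert (0 <= - (s * (c * d - 1)) * INR n) by (apply Rmult_le_pos; lra).
    assert (k * (s * (c * d - 1) * INR n + s * (2 * (c * d) - (c + d))) <= 0) by nra.
    assert (s * (g_coeff c d (S n) - g_coeff c d n)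
      = k * (s * (c * d - 1) * INR n + s * (2 * (c * d) - (c + d)))) by (rewrite E; ring).
    lra. }
  assert (Hlim : is_lim_seq alpha l)
    by apply (is_lim_seq_scal_l _ s _ (g_coeff_lim c d Hc Hd)).
  assert (Hser : is_series (fun n => (alpha n - l) / (INR n + 1)) (s * (Rcd c d / Beta c d))).
  { apply is_series_ext with (2 := is_series_scal s _ _ (g_coeff_series c d Hc Hd)).
    intros n. unfold scal; simpl; unfold mult; simpl. unfold alpha, l. pose proof (pos_INR n).
    field. lra. }
  destruct (int_series_defect_bounds alpha l _ x y Hdec Hlim Hser Hx Hy) as (H1 & H2 & H3).
  assert (HD : prob_sum_defect (int_series alpha) x y = s * Dg c d x y).
  { unfold prob_sum_defect, Dg, alpha.
    rewrite !int_series_scal, !g_int_series by assumption. ring. }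
  assert (H0 : alpha O = s) by (unfold alpha; rewrite g_coeff_0 by assumption; ring).
  rewrite HD in *. rewrite H0 in H2, H3.
  (* The first summand bounds the defect; the second is nonnegative because the series dominates its
     first term [s - l]. *)
  assert (HR : s * ((2 * Rcd c d + 1) / Beta c d - 1)
    = s * (Rcd c d / Beta c d) + (s * (Rcd c d / Beta c d) - (s - l))) by (unfold l; field; lra).
  rewrite HR. split; [lra|]. intros Hne.
  enough (l < s) by (specialize (H3 H); lra).
  pose proof (is_lim_seq_decr_compare _ _ Hlim Hdec 2%nat) as Hl2.
  apply Rle_lt_trans with (1 := Hl2).
  apply Rlt_le_trans with (alpha 1%nat); [|rewrite <- H0; apply Hdec].
  destruct (g_coeff_increment c d 1 Hc Hd) as (k & Hk & E). simpl INR in E.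
  assert (alpha 2%nat - alpha 1%nat = k * (s * (c * d - 1) + s * (2 * (c * d) - (c + d))))
    by (unfold alpha; rewrite <- Rmult_minus_distr_l, E; ring).
  enough (s * (c * d - 1) + s * (2 * (c * d) - (c + d)) < 0) by nra.
  destruct Hp1 as [Hp1|Hp1]; [lra|]. destruct Hp2 as [Hp2|Hp2]; [lra|].
  exfalso. apply Hne.
  assert (Hcancel : forall u, s * u = 0 -> u = 0).
  { intros u Hu. rewrite <- (Rmult_1_l u), <- Hs, Rmult_assoc, Hu. ring. }
  apply Hcancel in Hp1. apply Hcancel in Hp2.
  assert (Hc1 : (c - 1) * (c - 1) = 0) by (replace d with (2 - c) in Hp1 by lra; nra).
  apply Rmult_integral in Hc1. lra.
Qed.

(** At [c = d = 1], [g x = - ln (1 - x)], so [Dg] vanishes; since [Rcd 1 1 = 0] and [Beta 1 1 = 1],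
    the bound is [0] too, and strictness fails there. *)
Theorem theorem3p8 : forall c d : R, 0 < c -> 0 < d ->
  (c * d <= 1 ->
    forall x y : R, 0 < x < 1 -> 0 < y < 1 ->
      0 <= Dg c d x y <= (2 * Rcd c d + 1) / Beta c d - 1 /\
      (~ (c = 1 /\ d = 1) ->
        Dg c d x y < (2 * Rcd c d + 1) / Beta c d - 1)) /\
  (1 / c + 1 / d <= 2 ->
    forall x y : R, 0 < x < 1 -> 0 < y < 1 ->
      (2 * Rcd c d + 1) / Beta c d - 1 <= Dg c d x y <= 0 /\
      (~ (c = 1 /\ d = 1) ->
        (2 * Rcd c d + 1) / Beta c d - 1 < Dg c d x y)).
Proof.
  intros c d Hc Hd.
  assert (Hcd : 0 < c * d) by now apply Rmult_lt_0_compat.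
  assert (Hsq : 4 * (c * d) <= (c + d) * (c + d))
    by (pose proof (Rle_0_sqr (c - d)) as H; unfold Rsqr in H; lra).
  split; intros H x y Hx Hy.
  (* From [c * d <= 1]: [(2 * c * d) ^ 2 <= 4 * c * d <= (c + d) ^ 2]. *)
  - assert (Hs : 2 * (c * d) <= c + d).
    { assert (c * d * (c * d) <= c * d * 1) by (apply Rmult_le_compat_l; lra).
      apply Rsqr_incr_0; unfold Rsqr; lra. }
    destruct (defect_bounds c d 1 x y); lra.
  - assert (Hs : c + d <= 2 * (c * d)).
    { apply (Rmult_le_compat_l (c * d)) in H; [|lra].
      replace (c * d * (1 / c + 1 / d)) with (c + d) in H by (field; lra). lra. }
    (* Here [4 * c * d <= (c + d) ^ 2 <= (2 * c * d) ^ 2], divided by [4 * c * d]. *)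
    assert (1 <= c * d).
    { apply Rmult_le_reg_l with (1 := Hcd).
      assert ((c + d) * (c + d) <= 2 * (c * d) * (2 * (c * d)))
        by (apply Rmult_le_compat; lra). lra. }
    destruct (defect_bounds c d (-1) x y); lra.
Qed.
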